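(* Let $p$ be a prime, written as $p=n^2+\Delta$ with $n$ a positive integer and $1\le\Delta\le 2n$; let $R\subseteq\mathbb{F}_p$ be the set of quadratic residues, $\chi$ the Legendre symbol, and $A\subseteq\mathbb{F}_p$. (1) If $A\hat{+}A=R$ and it is not the case that $p=3$ and $A=\{0,1\}$, then $|A|=n+1$, $3\le\Delta\le n+1$, and $|2\cdot A\cap R|\le \frac12\sqrt{|A|\Delta-3|A|+1}$. If $0\notin A$ then $\chi(2)=1$ and $|A|\le 6$. If $0\in A$ then $\chi(2)=-1$, and if in addition $\Delta=n+1$ then $A$ is a perfect difference set. (2) If $A\hat{+}A=R$, define $\mathcal{E}_1$ and $\mathcal{E}_2:\mathbb{F}_p\to\mathbb{Z}$ by $$\mathsf{E}(A)=2|A|^2-|A|+\mathcal{E}_1,\qquad (A\circ A)(x)=(|A|-1)\delta_0(x)+1+\mathcal{E}_2(x).$$ Then $$\mathcal{E}_1\le 6(|A|-\Delta)+2|A|+\min\Big\{(|A|-\Delta)|A|,\ |A|\sqrt{3(|A|-\Delta)},\ (|A|-\Delta)^2\Big\},$$ $\sum_x\mathcal{E}_2(x)=|A|-\Delta$, and $\sum_x\mathcal{E}_2(x)^2=\mathcal{E}_1+\Delta-|A|$. (3) If $A\hat{+}A=R$, then $A$ is a perfect difference set; moreover if $|A|$ is even then $|A|\le 6$, and if $|A|$ is odd then $|A|\le5$.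
   Context: $R$ is the set of nonzero squares in $\mathbb{F}_p$; $\chi(x)=1$ on $R$, $-1$ on nonzero non-squares, $\chi(0)=0$. $A\hat{+}A=\{a+a': a,a'\in A,\ a\neq a'\}$, $2\cdot A=\{2a: a\in A\}$. $(A\circ A)(x)=\sum_y A(y)A(y+x)$, $\mathsf{E}(A)=\sum_x (A\circ A)(x)^2$ (additive energy), $\delta_0$ is the indicator of $\{0\}$. A perfect difference set is a set $A$ with $(A\circ A)(x)=1$ for all $x\ne0$.
   Formalization: The prime p is assumed odd: for p=2 (n=1, Δ=1) and A={0,1} one has A^+A=R, but Δ≥3 fails and A is not a perfect difference set. *)

(* Defs.v *)
From HB Require Import structures.
From mathcomp Require Import all_boot all_order all_algebra.

Set Implicit Arguments.
Unset Strict Implicit.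
Unset Printing Implicit Defensive.

Import GRing.Theory Num.Theory.

Local Open Scope ring_scope.

Definition quad_res (F : finFieldType) : {set F} :=
  [set x : F | (x != 0) && [exists y : F, x == y ^+ 2]].

Definition quad_char (F : finFieldType) (x : F) : int :=
  if x == 0 then 0 else if x \in quad_res F then 1 else -1.

Definition restricted_sumset (F : finFieldType) (A : {set F}) : {set F} :=
  [set a + b | a in A, b in A & a != b].

Definition double_set (F : finFieldType) (A : {set F}) : {set F} :=
  [set 2 * a | a in A].

(* A is identified with its indicator function, via the coercion of booleans
   to natural numbers. *)
Definition autocorr (F : finFieldType) (A : {set F}) (x : F) : nat :=
  (\sum_(y : F) (y \in A) * ((y + x)%R \in A))%N.

Definition additive_energy (F : finFieldType) (A : {set F}) : nat :=
  (\sum_(x : F) autocorr A x ^ 2)%N.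

Definition delta0 (F : finFieldType) (x : F) : int := if x == 0 then 1 else 0.

Definition perfect_difference_set (F : finFieldType) (A : {set F}) : Prop :=
  forall x : F, x != 0 -> autocorr A x = 1%N.

(* Main.v *)
Require Import Defs.
From HB Require Import structures.
From mathcomp Require Import all_boot all_order all_algebra.
From mathcomp Require Import finfield zify ring.

(* Put N = |A|, R the set of nonzero squares, f(x) = \sum_(a in A) chi(x + a).
   The first two moments of f over F_p are known, and f(a) = N - 1 + chi(2a)
   for a in A, so the second moment of f + 1 off A is explicit.  Comparing it
   with lower bounds that come from the parity of f, from the value
   f(0) = chi(2) \sum_a chi(2a), and, when N is odd and 0 is in A, from the
   fact that f + 1 is a polynomial of degree |R| over F_p, forces N = n + 1 and
   Delta = N, and forbids 2a in R for a in A.  Then p - 1 = N(N - 1), so each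
   element of R is a sum of two distinct elements of A in exactly one way, and
   A is a perfect difference set.  Evaluating \sum chi(y + a + b - c - d) over
   A^4 with the representation of differences, and again with that of sums, at
   y = 2a_0 gives a quadratic inequality in N that fails for N > 6. *)

Set Implicit Arguments.
Unset Strict Implicit.
Unset Printing Implicit Defensive.

Import Order.TTheory GRing.Theory Num.Theory.

Local Open Scope ring_scope.

(** * The quadratic character of a finite field of odd characteristic *)

Section QuadraticCharacter.

Variable F : finFieldType.
Hypothesis two_neq0 : (2 : F) != 0.

Local Notation R := (quad_res F).
Local Notation chi := (@quad_char F).

Lemma neq_opp (x : F) : x != 0 -> x != - x.
Proof.
by move=> x0; rewrite -subr_eq0 opprK -mulr2n -mulr_natl mulf_neq0.
Qed.

Lemma quad_res0 : (0 : F) \notin R.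
Proof. by rewrite inE eqxx. Qed.

Lemma quad_res_sqr (x : F) : x != 0 -> x ^+ 2 \in R.
Proof.
by move=> x0; rewrite inE sqrf_eq0 x0 /=; apply/existsP; exists x.
Qed.

(** Squaring is two-to-one on nonzero elements: the fibre over [y ^+ 2] is [{y, - y}], and
    [y != - y] because [2 != 0]. *)
Lemma card_quad_res : #|F| = (2 * #|R|).+1.
Proof.
rewrite (cardD1 0) inE add1n; congr _.+1.
rewrite -[LHS]sum1_card (partition_big (fun x : F => x ^+ 2) (mem R)) /=; last first.
  by move=> x; rewrite !inE andbT => x0; have := quad_res_sqr x0; rewrite inE.
rewrite -[#|R|]sum1_card big_distrr /=; apply: eq_bigr => r.
rewrite inE => /andP[r0 /existsP[y /eqP ry]].
have y0 : y != 0 by apply: contraNneq r0 => y0; rewrite ry y0 expr0n.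
rewrite sum1_card muln1.
transitivity #|[set y; - y]|; last by rewrite cards2 neq_opp.
apply: eq_card => x; rewrite unfold_in /= !inE andbT ry eqf_sqr.
apply: andb_idl; case/orP => /eqP-> //.
by rewrite oppr_eq0.
Qed.

Lemma expf_quad_res (x : F) : x \in R -> x ^+ #|R| = 1.
Proof.
rewrite inE => /andP[x0 /existsP[y /eqP xE]]; move: x0.
rewrite xE sqrf_eq0 => y0.
have := expf_card y; rewrite card_quad_res exprS -exprM => h.
by apply: (mulfI y0); rewrite h mulr1.
Qed.

Lemma card_quad_res_gt0 : (0 < #|R|)%N.
Proof.
by rewrite card_gt0; apply/set0Pn; exists (1 ^+ 2); rewrite quad_res_sqr ?oner_eq0.
Qed.

(** The elements of [R] are already [#|R|] roots of ['X^#|R| - 1], so there is no room for another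
    root. *)
Lemma quad_res_expE (x : F) : (x ^+ #|R| == 1) = (x \in R).
Proof.
apply/idP/idP => [x1|/expf_quad_res->//].
apply: contraTT isT => xR.
have P0 : 'X^#|R| - 1%:P != 0 :> {poly F}.
  by rewrite -size_poly_eq0 size_XnsubC ?card_quad_res_gt0.
have := @max_poly_roots _ ('X^#|R| - 1%:P : {poly F}) (x :: enum R) P0.
rewrite size_XnsubC ?card_quad_res_gt0 //= -cardE ltnn => -> //.
  apply/andP; split; first by rewrite rootE !hornerE subr_eq0.
  by apply/allP => y; rewrite mem_enum => /expf_quad_res; rewrite rootE !hornerE => ->; rewrite subrr.
by rewrite mem_enum xR enum_uniq.
Qed.

Lemma euler_criterion (x : F) : (chi x)%:~R = x ^+ #|R|.
Proof.
rewrite /quad_char; have [->|x0] := eqVneq x 0.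
  by rewrite expr0n gtn_eqF ?card_quad_res_gt0.
case: ifP => xR; first by rewrite expf_quad_res.
apply/eqP; move: xR; rewrite -quad_res_expE => xR.
have := expf_card x; rewrite card_quad_res exprS mulnC exprM => h.
have {}h : (x ^+ #|R|) ^+ 2 = 1 ^+ 2 by apply: (mulfI x0); rewrite h expr1n mulr1.
by move/eqP: h; rewrite eqf_sqr xR /= eq_sym.
Qed.

Variant quad_char_spec (x : F) : int -> bool -> bool -> Type :=
  | QuadChar0 of x = 0 : quad_char_spec x 0 true false
  | QuadChar1 of x \in R : quad_char_spec x 1 false true
  | QuadCharN1 of x != 0 & x \notin R : quad_char_spec x (-1) false false.

Lemma quad_charP (x : F) : quad_char_spec x (chi x) (x == 0) (x \in R).
Proof.
rewrite /quad_char; case: (eqVneq x 0) => [->|x0].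
  by rewrite (negbTE quad_res0); constructor.
by case: (boolP (x \in R)) => xR; constructor.
Qed.

Lemma quad_char_bounds (x : F) : -1 <= chi x <= 1.
Proof. by case: quad_charP. Qed.

(** Brings identities between values of [chi] back from [F], where Euler's criterion proves them, to
    the integers. *)
Lemma small_intr_eq0 (d : int) : -2 <= d <= 2 -> d%:~R = 0 :> F -> d = 0.
Proof.
have n1 : (1 : F) != 0 by exact: oner_neq0.
move=> hd h; have [//|d0] := eqVneq d 0.
have [d1|[d1|[d1|d1]]] : d = 1 \/ d = -1 \/ d = 2 \/ d = -2 by lia.
- by move: n1; rewrite -h d1 eqxx.
- by move: n1; rewrite -oppr_eq0 -h d1 mulrN1z eqxx.
- by move: two_neq0; rewrite -h d1 eqxx.
- by move: two_neq0; rewrite -oppr_eq0 -h d1 mulrNz eqxx.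
Qed.

Lemma quad_charM (x y : F) : chi (x * y) = chi x * chi y.
Proof.
apply/eqP; rewrite -subr_eq0; apply/eqP/small_intr_eq0; last first.
  by rewrite intrB intrM !euler_criterion exprMn subrr.
have := quad_char_bounds (x * y).
by case: (quad_charP x) => ?; case: (quad_charP y) => ?; lia.
Qed.

Lemma quad_char1 : chi 1 = 1.
Proof.
case: quad_charP => // [/eqP|_]; first by rewrite (negbTE (oner_neq0 _)).
by rewrite -(expr1n _ 2) quad_res_sqr ?oner_neq0.
Qed.

Lemma quad_char0 : chi 0 = 0.
Proof. by rewrite /quad_char eqxx. Qed.

Lemma quad_char_res (x : F) : x \in R -> chi x = 1.
Proof. by case: quad_charP. Qed.

Lemma quad_char_sqr (x : F) : x != 0 -> chi x * chi x = 1.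
Proof. by case: quad_charP. Qed.

Lemma quad_charE (x : F) : chi x = 2 * (x \in R)%:Z - 1 + (x == 0)%:Z.
Proof. by case: quad_charP. Qed.

Lemma sum_indicator (T : finType) (P : pred T) : \sum_x (P x)%:Z = #|P|%:Z.
Proof.
rewrite -sum1_card -[RHS]natz natr_sum [RHS]big_mkcond /=.
by apply: eq_bigr => x _; rewrite unfold_in; case: (P x).
Qed.

Lemma sum_quad_char : \sum_x chi x = 0.
Proof.
rewrite (eq_bigr (fun x : F => 2 * (x \in R)%:Z - 1 + (x == 0)%:Z)); last first.
  by move=> x _; exact: quad_charE.
rewrite !big_split /= -mulr_sumr (sum_indicator (mem R)) (sum_indicator (pred1 0)).
rewrite sumr_const card1 -mulr_natr natz card_quad_res.
by set c := #|_|; lia.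
Qed.

Lemma sum_quad_char_shift (a : F) : \sum_x chi (x + a) = 0.
Proof.
by rewrite -[RHS]sum_quad_char [RHS](reindex_inj (addIr a)).
Qed.

Lemma sum_quad_charMD (t : F) :
  \sum_x chi x * chi (x + t) = #|F|%:Z * (t == 0)%:Z - 1.
Proof.
rewrite (bigD1 0) //= quad_char0 mul0r add0r; have [->|t0] := eqVneq t 0.
  rewrite (eq_bigr (fun=> 1)); last by move=> x x0; rewrite addr0 quad_char_sqr.
  by rewrite sumr_const (cardC1 (0 : F)) natz card_quad_res; lia.
(* Factoring out the square [x * x] leaves [1 + t / x], which for [x != 0] runs over every element
   except 1. *)
rewrite (eq_bigr (fun x => chi (x^-1 * t + 1))) => [|x x0]; last first.
  rewrite -quad_charM -[x * (x + t)](_ : x * x * (x^-1 * t + 1) = _).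
    by rewrite !quad_charM quad_char_sqr // mul1r.
  by field.
rewrite (reindex_inj invr_inj) /=.
rewrite (eq_bigr (fun x => chi (x * t + 1))) => [|x x0]; last by rewrite invrK.
rewrite (eq_bigl (fun x => x != 0)) => [|x]; last by rewrite invr_eq0.
have := sum_quad_char_shift 1.
rewrite (reindex_inj (mulIf t0)) /= (bigD1 0) //= mul0r add0r quad_char1.
by move/eqP; rewrite addrC addr_eq0 mulr0 sub0r => /eqP <-.
Qed.

Lemma sum_quad_charDD (a b : F) :
  \sum_x chi (x + a) * chi (x + b) = #|F|%:Z * (a == b)%:Z - 1.
Proof.
rewrite (reindex_inj (addIr (- a))) /=.
rewrite (eq_bigr (fun x => chi x * chi (x + (b - a)))) => [|x _].
  by rewrite sum_quad_charMD subr_eq0 eq_sym.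
by rewrite subrK -addrA [- a + b]addrC.
Qed.

End QuadraticCharacter.

(** * The sum of the character over translates by [A]: moments, parity, fibres *)

Section CharacterSum.

Variable F : finFieldType.
Hypothesis two_neq0 : (2 : F) != 0.

Local Notation R := (quad_res F).
Local Notation chi := (@quad_char F).

Definition char_sum (A : {set F}) (x : F) : int := \sum_(a in A) chi (x + a).

Variable A : {set F}.
Local Notation f := (char_sum A).
Local Notation N := (#|A|%:Z).

Lemma sum1_int : \sum_(a in A) 1 = N.
Proof. by rewrite sumr_const natz. Qed.

Lemma sum_char_sum : \sum_x f x = 0.
Proof.
by rewrite exchange_big /= big1 // => a _; exact: sum_quad_char_shift.
Qed.

Lemma sum_char_sum_sqr : \sum_x f x ^+ 2 = #|F|%:Z * N - N ^+ 2.
Proof.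
rewrite (eq_bigr (fun x => \sum_(a in A) \sum_(b in A) chi (x + a) * chi (x + b))).
  rewrite exchange_big /= (eq_bigr (fun=> #|F|%:Z - N)).
    by rewrite sumr_const -mulr_natr natz; ring.
  move=> a aA; rewrite exchange_big /=.
  rewrite (eq_bigr (fun b => #|F|%:Z * (a == b)%:Z - 1)) => [|b _]; last first.
    exact: sum_quad_charDD.
  rewrite big_split /= sumrN sum1_int -mulr_sumr (bigD1 a) //= eqxx.
  rewrite big1 ?addr0 ?mulr1 // => b /andP[_].
  by rewrite eq_sym => /negbTE->.
move=> x _; rewrite expr2 mulr_suml; apply: eq_bigr => a _.
exact: mulr_sumr.
Qed.

(** Every term [chi (x + a)] is odd except the one with [a = - x], which is 0 and occurs exactly
    when [- x] is in [A]. *)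
Lemma char_sum_parity (x : F) :
  exists k : int, f x = 2 * k - N + (- x \in A)%:Z.
Proof.
exists (\sum_(a in A) (x + a \in R)%:Z).
rewrite /char_sum (eq_bigr _ (fun a _ => quad_charE (x + a))).
rewrite !big_split /= -mulr_sumr sumrN sum1_int; congr (_ + _).
rewrite big_mkcond (bigD1 (- x)) //= subrr eqxx big1 => [|a ax].
  by rewrite addr0; case: ifP.
by rewrite addrC addr_eq0 (negbTE ax) if_same.
Qed.

Lemma sum_opp_mem : \sum_x (- x \in A)%:Z = N.
Proof.
rewrite (reindex_inj oppr_inj) /= (eq_bigr (fun x => (x \in A)%:Z)) => [|x _].
  exact: (sum_indicator (mem A)).
by rewrite opprK.
Qed.

(* Over F the function char_sum A is the polynomial \sum_a ('X + a)^#|R|. *)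
Lemma card_char_sum_fiber (c : int) : (#|A|%:R : F) != 0 ->
  (#|[set x | f x == c]| <= #|R|)%N.
Proof.
move=> N0; set m := #|R|.
pose P : {poly F} := \sum_(a in A) ('X + a%:P) ^+ m - (c%:~R)%:P.
have szP1 (a : F) : size (('X + a%:P) ^+ m) = m.+1.
  by rewrite -[a]opprK polyCN size_exp_XsubC.
have Pm : P`_m = #|A|%:R.
  rewrite coefB coefC gtn_eqF ?card_quad_res_gt0 // subr0 coef_sum.
  rewrite (eq_bigr (fun=> 1)) ?sumr_const // => a _.
  have /monicP := monic_exp m (monicXaddC a).
  by rewrite lead_coefE szP1.
have P0 : P != 0 by apply: contraNneq N0 => P0; rewrite -Pm P0 coef0.
have szP : (size P <= m.+1)%N.
  apply: (leq_trans (size_polyD _ _)); rewrite geq_max size_polyN.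
  rewrite (leq_trans (size_polyC_leq1 _)) // andbT.
  apply: (leq_trans (size_sum _ _ _)).
  by apply/bigmax_leqP => a _; rewrite szP1.
have := @max_poly_roots _ P (enum [set x | f x == c]) P0.
rewrite -cardE => h; rewrite -ltnS; apply: leq_trans szP; apply: h.
  apply/allP => x; rewrite mem_enum inE => /eqP fx.
  rewrite rootE hornerD hornerN hornerC horner_sum -fx /char_sum.
  rewrite (big_morph _ (@intrD F) (mulr0z 1)) -sumrB big1 // => a _.
  by rewrite euler_criterion // horner_exp hornerD hornerX hornerC subrr.
exact: enum_uniq.
Qed.

End CharacterSum.

(** * First consequences of the equation for the restricted sumset *)

Section RestrictedSumset.

Variable F : finFieldType.
Hypothesis two_neq0 : (2 : F) != 0.

Local Notation R := (quad_res F).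
Local Notation chi := (@quad_char F).

Variable A : {set F}.
Hypothesis sumsetA : restricted_sumset A = R.
Local Notation f := (char_sum A).
Local Notation N := (#|A|%:Z).
Local Notation q := (#|F|%:Z).
Local Notation z := ((0 \in A)%:Z).
Local Notation s := (\sum_(a in A) chi (2 * a)).

Lemma add_mem_quad_res (a b : F) :
  a \in A -> b \in A -> a != b -> a + b \in R.
Proof.
move=> aA bA ab; rewrite -sumsetA; apply/imset2P.
by exists a b; rewrite ?inE ?bA.
Qed.

Lemma quad_res_addP (r : F) : r \in R ->
  exists a b, [/\ a \in A, b \in A, a != b & r = a + b].
Proof.
rewrite -sumsetA => /imset2P[a b aA]; rewrite inE => /andP[bA ab] ->.
by exists a, b.
Qed.

(** Otherwise [0 = x + (- x)] would be a sum of two distinct elements of [A], hence in [R]. *)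
Lemma opp_mem_eq0 (x : F) : x \in A -> (- x \in A) = (x == 0).
Proof.
move=> xA; apply/idP/eqP => [nxA|x0]; last first.
  by move: xA; rewrite x0 oppr0.
apply/eqP; apply: contraTT isT => x0.
by have := add_mem_quad_res xA nxA (neq_opp two_neq0 x0); rewrite subrr (negbTE (quad_res0 F)).
Qed.

Lemma char_sum_mem (a : F) : a \in A -> f a = N - 1 + chi (2 * a).
Proof.
move=> aA; rewrite -(sum1_int A) /char_sum (bigD1 a) // [in RHS](bigD1 a) //=.
rewrite -mulr2n -[a *+ 2]mulr_natl (eq_bigr (fun=> 1)) => [|b /andP[bA ba]].
 by rewrite [1 + _]addrC addrK addrC.
by rewrite quad_char_res // add_mem_quad_res // eq_sym.
Qed.

Lemma sum_mem_zero : \sum_(x in A) (x == 0)%:Z = z.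
Proof.
rewrite big_mkcond (bigD1 0) //= big1 => [|x x0].
  by rewrite eqxx addr0; case: ifP.
by rewrite (negbTE x0) if_same.
Qed.

Lemma sum_opp_mem_off : \sum_(x | x \notin A) (- x \in A)%:Z = N - z.
Proof.
rewrite -(sum_opp_mem A) [X in _ = X - _](bigID (mem A)) /=.
rewrite [X in _ = X + _ - _](eq_bigr (fun x => (x == 0)%:Z)) => [|x xA].
  by rewrite sum_mem_zero [z + _]addrC addrK.
by rewrite opp_mem_eq0.
Qed.

Lemma sum1_off : \sum_(x | x \notin A) 1 = q - N.
Proof.
have := sumr_const F (1 : int); rewrite natz (bigID (mem A)) /= sum1_int => <-.
by rewrite [N + _]addrC addrK.
Qed.

(** The sum over all of [F] follows from the two moments. On [A] the shifted value is
    [N + chi (2 * a)], whose square involves only [chi (2 * a)] and whether [a = 0]. *)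
Lemma sum_char_sum_off :
  \sum_(x | x \notin A) (f x + 1) ^+ 2 =
    q * N - N ^+ 2 + q - N ^+ 3 - 2 * N * s - N + z.
Proof.
have tot : \sum_x (f x + 1) ^+ 2 = q * N - N ^+ 2 + q.
  rewrite (eq_bigr (fun x => f x ^+ 2 + 2 * f x + 1)) => [|x _]; last by ring.
  rewrite !big_split /= sum_char_sum_sqr // -mulr_sumr sum_char_sum //.
  by rewrite sumr_const mulr0 addr0 !natz.
have onA : \sum_(x in A) (f x + 1) ^+ 2 = N ^+ 3 + 2 * N * s + (N - z).
  rewrite (eq_bigr (fun x => N ^+ 2 + 2 * N * chi (2 * x) + (1 - (x == 0)%:Z))).
    rewrite !big_split /= -(mulr_sumr _ _ _ (2 * N)) sumrN sum_mem_zero sum1_int.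
    by rewrite sumr_const -[N ^+ 2 *+ _]mulr_natr natz; ring.
  move=> x xA; rewrite char_sum_mem //.
  have := quad_charP (2 * x); rewrite mulf_eq0 (negbTE two_neq0) /=.
  by case=> *; rewrite /=; ring.
move: tot; rewrite (bigID (mem A)) /= onA => h.
by apply/eqP; rewrite -subr_eq0 -[_ * N - _ + _]h; apply/eqP; ring.
Qed.

(** The pairs are ordered, so an unordered representation counts twice. *)
Definition sum_reps (r : F) : {set F * F} :=
  [set ab | [&& ab.1 \in A, ab.2 \in A, ab.1 != ab.2 & ab.1 + ab.2 == r]].

Lemma sum_card_reps : (\sum_(r in R) #|sum_reps r| = #|A| * #|A|.-1)%N.
Proof.
transitivity (\sum_(a in A) \sum_(b in A | a != b) 1)%N; last first.
  rewrite (eq_bigr (fun=> #|A|.-1)) => [|a aA]; first by rewrite sum_nat_const.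
  rewrite sum1_card (cardD1 a A) aA add1n /=.
  by apply: eq_card => b; rewrite !inE eq_sym andbC.
rewrite pair_big_dep /= (partition_big (fun ab => ab.1 + ab.2) (mem R)) /=.
  apply: eq_bigr => r _; rewrite -sum1_card; apply: eq_bigl => ab.
  by rewrite inE !andbA.
by move=> [a b] /= /and3P[aA bA ab]; exact: add_mem_quad_res.
Qed.

Lemma card_reps_ge2 (r : F) : r \in R -> (2 <= #|sum_reps r|)%N.
Proof.
move=> /quad_res_addP[a [b [aA bA ab ->]]].
rewrite -(_ : #|[set (a, b); (b, a)]| = 2%N); last first.
  by rewrite cards2 xpair_eqE negb_and ab.
apply/subset_leq_card/subsetP => ab'; rewrite !inE => /orP[] /eqP-> /=.
  by rewrite aA bA ab eqxx.
by rewrite aA bA eq_sym ab addrC eqxx.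
Qed.

Lemma card_quad_res_le : (2 * #|R| <= #|A| * #|A|.-1)%N.
Proof.
rewrite -sum_card_reps mulnC -sum_nat_const leq_sum // => r.
exact: card_reps_ge2.
Qed.

End RestrictedSumset.

(** * Lower bounds for the second moment off [A], and the size of [A] *)

Section SizeOfSummand.

Variable F : finFieldType.
Hypothesis two_neq0 : (2 : F) != 0.

Local Notation R := (quad_res F).
Local Notation chi := (@quad_char F).

Variable A : {set F}.
Hypothesis sumsetA : restricted_sumset A = R.
Local Notation f := (char_sum A).
Local Notation N := (#|A|%:Z).
Local Notation q := (#|F|%:Z).
Local Notation z := ((0 \in A)%:Z).
Local Notation s := (\sum_(a in A) chi (2 * a)).
Local Notation S := (q * N - N ^+ 2 + q - N ^+ 3 - 2 * N * s - N + z).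

Lemma sum_double_bounds : - (N - z) <= s <= N.
Proof.
apply/andP; split; last first.
  rewrite -(sum1_int A); apply: ler_sum => a _.
  by case/andP: (quad_char_bounds (2 * a)).
rewrite -(sum_mem_zero A) -(sum1_int A) -sumrB -sumrN; apply: ler_sum => a _.
have := quad_charP (2 * a); rewrite mulf_eq0 (negbTE two_neq0) /=.
by case.
Qed.

Lemma char_sum0 : chi 2 * f 0 = s.
Proof.
rewrite mulr_sumr; apply: eq_bigr => a _.
by rewrite add0r quad_charM.
Qed.

Lemma sum_off_zero (c : int) : \sum_(x | x \notin A) (x == 0)%:Z * c = (1 - z) * c.
Proof.
rewrite -mulr_suml; congr (_ * _).
rewrite big_mkcond (bigD1 0) //= big1 => [|x x0].
  by rewrite eqxx addr0; case: (0 \in A).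
by rewrite (negbTE x0) if_same.
Qed.

(** Reduces each bound below to the choice of a pointwise minorant [w]. *)
Lemma char_sum_off_lower (w : F -> int) :
  (forall x, x \notin A -> w x <= (f x + 1) ^+ 2) ->
  \sum_(x | x \notin A) w x <= S.
Proof. by move=> h; rewrite -sum_char_sum_off //; exact: ler_sum. Qed.

Lemma char_sum_off_ge0 : 0 <= S.
Proof.
have := @char_sum_off_lower (fun=> 0) (fun x _ => sqr_ge0 _).
by rewrite big1_eq.
Qed.

(** For even [#|A|] the integer [f x + 1] is odd, so its square is at least 1, unless [- x] is in
    [A]. The point 0, when off [A], is counted with its exact value. *)
Lemma char_sum_off_even : ~~ odd #|A| ->
  q - 2 * N + z + (1 - z) * ((f 0 + 1) ^+ 2 - 1) <= S.
Proof.
move=> evA; pose w x : int :=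
  1 - (- x \in A)%:Z + (x == 0)%:Z * ((f 0 + 1) ^+ 2 - 1).
have := @char_sum_off_lower w; rewrite {2}/w !big_split /= sum1_off sumrN.
rewrite sum_opp_mem_off // sum_off_zero => h.
have {h} h := h _; apply: le_trans (h _) => [|x xA].
  by rewrite le_eqVlt; apply/orP; left; apply/eqP; ring.
have [k fx] := char_sum_parity A x; rewrite /w.
have [->|x0] := eqVneq x 0; first by have := ler0n int (- 0 \in A); lia.
rewrite fx; case: (- x \in A) => /=; first by rewrite mul0r; exact: sqr_ge0.
rewrite mul0r addr0 subr0 -gtz0_ge1 lt_def sqr_ge0 sqrf_eq0 andbT.
by move: evA; move: #|A| => M evM; lia.
Qed.

(** For odd [#|A|] the parity is reversed: [f x + 1] is odd exactly when [- x] is in [A]. *)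
Lemma char_sum_off_odd : odd #|A| ->
  N - z + (1 - z) * (f 0 + 1) ^+ 2 <= S.
Proof.
move=> oA; pose w x : int := (- x \in A)%:Z + (x == 0)%:Z * (f 0 + 1) ^+ 2.
have := @char_sum_off_lower w; rewrite {2}/w !big_split /=.
rewrite sum_opp_mem_off // sum_off_zero; apply => x xA.
have [k fx] := char_sum_parity A x; rewrite /w.
have [x0|x0] := eqVneq x 0.
  by move: xA; rewrite x0 oppr0 => /negbTE->; rewrite mul1r add0r.
rewrite mul0r addr0 fx; case: (- x \in A) => /=; last exact: sqr_ge0.
rewrite -gtz0_ge1 lt_def sqr_ge0 sqrf_eq0 andbT.
by move: oA; move: #|A| => M oM; lia.
Qed.

(** Where [- x] is not in [A], [f x + 1] is even, so its square is 0 or at least 4; the fibre bound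
    allows at most [#|R|] zeros. *)
Lemma char_sum_off_odd_roots : odd #|A| -> (#|A|%:R : F) != 0 ->
  N - z + 4 * (q - 2 * N + z) - 4 * #|R|%:Z <= S.
Proof.
move=> oA N0; pose w x : int :=
  (- x \in A)%:Z + 4 * (1 - (- x \in A)%:Z - (f x == -1)%:Z).
have := @char_sum_off_lower w; rewrite {2}/w big_split /= -mulr_sumr !big_split /=.
rewrite !sumrN sum1_off sum_opp_mem_off // => h.
have roots : \sum_(x | x \notin A) (f x == -1)%:Z <= #|R|%:Z.
  rewrite (le_trans (y := \sum_x (f x == -1)%:Z)) //.
    rewrite [leRHS](bigID (mem A)) /= lerDr; apply: sumr_ge0 => x _.
    by case: (f x == -1).
  by have := card_char_sum_fiber two_neq0 (-1) N0; rewrite sum_indicator cardsE.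
have hw x : x \notin A -> w x <= (f x + 1) ^+ 2.
  move=> xA; have [k fx] := char_sum_parity A x; rewrite /w fx.
  clear -oA; move: oA; move: #|A| => M oM; case: (- x \in A) => /=.
    case: eqP => [|_]; first by lia.
    apply: (@le_trans _ _ 1) => //.
    by rewrite -gtz0_ge1 lt_def sqr_ge0 sqrf_eq0; lia.
  case: eqP => [->//|ne]; apply: (@le_trans _ _ 4) => //.
  rewrite addr0 (_ : _ + 1 = 2 * (k - M./2%:Z)); last by lia.
  by rewrite exprMn; have : 1 <= (k - M./2%:Z) ^+ 2; [nia|lia].
apply: le_trans (h hw); rewrite -subr_ge0.
rewrite (_ : _ - _ = 4 * (#|R|%:Z - \sum_(x | x \notin A) (f x == -1)%:Z)).
  by rewrite mulr_ge0 ?subr_ge0.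
by ring.
Qed.

Variables n Delta : nat.
Hypothesis n_gt0 : (0 < n)%N.
Hypothesis cardF : #|F| = (n ^ 2 + Delta)%N.
Hypothesis Delta_gt0 : (0 < Delta)%N.
Hypothesis Delta_le : (Delta <= 2 * n)%N.

Lemma card_summand : #|A| = n.+1.
Proof.
have SA := char_sum_off_ge0; have /andP[sA _] := sum_double_bounds.
have qR := card_quad_res two_neq0; have RA := card_quad_res_le sumsetA.
have z01 : z = 0 \/ z = 1 by case: (0 \in A); [right|left].
move: SA sA z01; move: (s) z => s' z' SA sA z01.
(* Counting pairs gives [n ^ 2 <= q - 1 <= N * (N - 1)]. *)
have geN : (n < #|A|)%N by nia.
apply/eqP; rewrite eqn_leq geN andbT leqNgt; apply/negP => ltN.
(* If [n + 2 <= N], then [q + 1 <= (n + 1) ^ 2 <= (N - 1) ^ 2]. With [s >= - (N - z)] this makes the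
   second moment off [A] negative. *)
have q_le : q <= N ^+ 2 - 2 * N by nia.
have : N * (s' + N - z') >= 0 by nia.
have : (N + 1) * q <= (N + 1) * (N ^+ 2 - 2 * N) by nia.
nia.
Qed.

End SizeOfSummand.

(* The right-hand side of each inequality is the second moment of f + 1 off A
   for q = (N - 1)^2 + D, and c stands for chi 2.  For 0 \notin A one has
   f 0 = c * s, and for 0 \in A one has s = c * (N - 1). *)
Lemma odd_parameters_notin0 (N D s c : int) :
  0 < N -> D <= N -> - N <= s <= N -> c = 1 \/ c = -1 ->
  N + (c * s + 1) ^+ 2 <=
    ((N - 1) ^+ 2 + D) * N - N ^+ 2 + ((N - 1) ^+ 2 + D) - N ^+ 3 - 2 * N * s - N ->
  [/\ D = N, s = - N & c = 1].
Proof.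
move=> N0 DN sN [] -> h.
  have key : (N + s) ^+ 2 + 2 * (N + s) <= (N + 1) * (D - N) by lia.
  have sE : s = - N by nia.
  by split=> //; rewrite sE in key; nia.
have key : (N + s) ^+ 2 + 2 * (N - s) <= (N + 1) * (D - N) by lia.
have sE : s = N by nia.
by rewrite sE in key; nia.
Qed.

(** The inequality forces [N ^ 2 - 4 * N <= 0], leaving [N = 2] and [N = 4]; the parities of [D] and
    [s] settle [N = 2]. *)
Lemma even_parameters_notin0 (N D s c k l : int) :
  0 < N -> 0 < D <= N -> - N <= s <= N -> c = 1 \/ c = -1 ->
  N = 2 * k -> D = 2 * l -> (exists j, s = 2 * j) ->
  (N - 1) ^+ 2 + D - 2 * N + ((c * s + 1) ^+ 2 - 1) <=
    ((N - 1) ^+ 2 + D) * N - N ^+ 2 + ((N - 1) ^+ 2 + D) - N ^+ 3 - 2 * N * s - N ->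
  [/\ D = N, s = - N & c = 1].
Proof.
move=> N0 DN sN c1 Nk Dl [j sj] h.
have key : N ^+ 2 - 4 * N + (N + s) ^+ 2 + 2 * (N + c * s) <= N * (D - N).
  by case: c1 h => ->; lia.
have cs : 0 <= N + c * s by case: c1 => ->; lia.
have N4 : N <= 4 by nia.
have [N2|N2] : N = 2 \/ N = 4 by lia.
  have DE : D = 2 by lia.
  rewrite N2 DE in key sN *; have : s = -2 \/ s = 0 \/ s = 2 by lia.
  by case=> [|[]] sE; rewrite sE in key *; case: c1 key => ->.
rewrite N2 in key sN cs DN *.
have sE : s = -4 by nia.
by rewrite sE in key cs *; split=> //; case: c1 key cs => ->; lia.
Qed.

Lemma quad_char2_parameters_in0 (N D c : int) : 2 <= N -> D <= N -> c = 1 \/ c = -1 ->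
  0 <= ((N - 1) ^+ 2 + D) * N - N ^+ 2 + ((N - 1) ^+ 2 + D) - N ^+ 3
         - 2 * N * (c * (N - 1)) - N + 1 -> c = -1.
Proof. by move=> N2 DN [] -> //; nia. Qed.

Lemma even_parameters_in0 (N D : int) : 2 <= N -> D <= N ->
  (N - 1) ^+ 2 + D - 2 * N + 1 <=
    ((N - 1) ^+ 2 + D) * N - N ^+ 2 + ((N - 1) ^+ 2 + D) - N ^+ 3
      - 2 * N * (- (N - 1)) - N + 1 -> D = N.
Proof. by move=> N2 DN h; have : 0 <= N * (D - N); [lia|nia]. Qed.

(** The root-counting bound factors as [(N - 1) * (2 * N - 5 - D) <= 0], so [N] is 3 or 5. The
    parity bound settles [N = 3], and [D >= 2 * N - 5] settles [N = 5]. *)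
Lemma odd_parameters_in0 (N D m k l : int) : 2 <= N -> D <= N ->
  N = 2 * k + 1 -> D = 2 * l + 1 -> (N - 1) ^+ 2 + D = 2 * m + 1 ->
  N - 1 <=
    ((N - 1) ^+ 2 + D) * N - N ^+ 2 + ((N - 1) ^+ 2 + D) - N ^+ 3
      - 2 * N * (- (N - 1)) - N + 1 ->
  N - 1 + 4 * ((N - 1) ^+ 2 + D - 2 * N + 1) - 4 * m <=
    ((N - 1) ^+ 2 + D) * N - N ^+ 2 + ((N - 1) ^+ 2 + D) - N ^+ 3
      - 2 * N * (- (N - 1)) - N + 1 -> D = N.
Proof.
move=> N2 DN Nk Dl qm h1 h2.
have key : (N - 1) * (2 * N - 5 - D) <= 0 by lia.
have key1 : 5 * N - 3 <= (N + 1) * D by lia.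
clear h1 h2 qm; have D_ge : 2 * N - 5 <= D.
  by move: key; rewrite pmulr_rle0; lia.
have [N3|N5] : N = 3 \/ N = 5 by lia.
  by rewrite N3 in key1 DN *; lia.
by rewrite N5 in DN D_ge *; lia.
Qed.

(** * Determination of [Delta], of [chi 2], and of the doubles of elements of [A] *)

Section Classification.

Variable F : finFieldType.
Hypothesis two_neq0 : (2 : F) != 0.

Local Notation R := (quad_res F).
Local Notation chi := (@quad_char F).

Variable A : {set F}.
Hypothesis sumsetA : restricted_sumset A = R.
Local Notation f := (char_sum A).
Local Notation N := (#|A|%:Z).
Local Notation q := (#|F|%:Z).
Local Notation z := ((0 \in A)%:Z).
Local Notation s := (\sum_(a in A) chi (2 * a)).
Local Notation S := (q * N - N ^+ 2 + q - N ^+ 3 - 2 * N * s - N + z).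

Variables n Delta : nat.
Hypothesis n_gt0 : (0 < n)%N.
Hypothesis cardF : #|F| = (n ^ 2 + Delta)%N.
Hypothesis Delta_gt0 : (0 < Delta)%N.
Hypothesis Delta_le : (Delta <= 2 * n)%N.


Lemma Delta_le_card : (Delta <= #|A|)%N.
Proof.
have NA := card_summand two_neq0 sumsetA n_gt0 cardF Delta_gt0 Delta_le.
have := card_quad_res two_neq0; have := card_quad_res_le sumsetA.
by rewrite cardF NA; nia.
Qed.

Lemma cardFE : q = (N - 1) ^+ 2 + Delta%:Z.
Proof.
by rewrite cardF (card_summand two_neq0 sumsetA n_gt0 cardF Delta_gt0 Delta_le); lia.
Qed.

Lemma Delta_parity : odd Delta = odd #|A|.
Proof.
rewrite (card_summand two_neq0 sumsetA n_gt0 cardF Delta_gt0 Delta_le) /=.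
have := card_quad_res two_neq0; rewrite cardF => /(congr1 odd).
by rewrite oddD oddX /= oddM /= => /(canRL (addKb _)) ->; rewrite addbT.
Qed.

Lemma quad_char2 : chi 2 = 1 \/ chi 2 = -1.
Proof.
case: (quad_charP (2 : F)) => [h|_|_ _]; [|by left|by right].
by have := two_neq0; rewrite h eqxx.
Qed.

(** Each nonzero [a] in [A] equals [0 + a], hence is in [R], and [chi (2 * a) = chi 2]. *)
Lemma sum_double0 : 0 \in A -> s = chi 2 * (N - 1).
Proof.
move=> A0; rewrite -(sum1_int A) (bigD1 0) //= mulr0 quad_char0 add0r.
rewrite [X in _ = _ * (X - 1)](bigD1 0) //= [1 + _]addrC addrK mulr_sumr.
apply: eq_bigr => a /andP[aA a0]; rewrite quad_charM // (quad_char_res (x := a)) //.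
by rewrite -[a]add0r (add_mem_quad_res sumsetA) // eq_sym.
Qed.

Hypothesis N_neq0 : (#|A|%:R : F) != 0.

(** Four cases, by the parity of [#|A|] and by whether 0 is in [A]. Each feeds its second-moment
    bounds to the matching integer lemma; the case of odd [#|A|] with 0 in [A] calls on the root
    count as well. *)
Lemma summand_parameters :
  [/\ Delta = #|A|, s = - (N - z), 0 \notin A -> chi 2 = 1 & 0 \in A -> chi 2 = -1].
Proof.
have NE := card_summand two_neq0 sumsetA n_gt0 cardF Delta_gt0 Delta_le.
have N2 : (1 < #|A|)%N by rewrite NE.
have DN := Delta_le_card; have qE := cardFE; have par := Delta_parity.
have cc := quad_char2.
suff : [/\ Delta%:Z = N, s = - (N - z), 0 \notin A -> chi 2 = 1 & 0 \in A -> chi 2 = -1].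
  by case=> -[].
have [A0|A0] := boolP (0 \in A); last first.
  have sN := sum_double_bounds two_neq0 A; rewrite (negbTE A0) subr0 in sN *.
  have f0E : f 0 = chi 2 * s.
    by rewrite -char_sum0 // mulrA; case: cc => ->; rewrite ?mul1r // mulN1r mulrNN !mul1r.
  suff [-> -> ->] : [/\ Delta%:Z = N, s = - N & chi 2 = 1] by split.
  have [oA|eA] := boolP (odd #|A|).
    have := char_sum_off_odd two_neq0 sumsetA oA.
    rewrite (negbTE A0) f0E qE subr0 subr0 mul1r addr0.
    by apply: odd_parameters_notin0 => //; lia.
  have := char_sum_off_even two_neq0 sumsetA eA.
  rewrite (negbTE A0) f0E qE subr0 mul1r !addr0.
  apply: (@even_parameters_notin0 _ _ _ _ (#|A|./2)%:Z (Delta./2)%:Z) => //.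
  - by lia.
  - by lia.
  - by move: eA; move: #|A| => M; lia.
  - by move: par; rewrite (negbTE eA); lia.
  have [k] := char_sum_parity A 0; rewrite oppr0 (negbTE A0) addr0 f0E.
  case: cc => ->; rewrite ?mul1r ?mulN1r => sk.
    by exists (k - (#|A|./2)%:Z); rewrite sk; move: eA; move: #|A| => M; lia.
  exists (- k + (#|A|./2)%:Z); rewrite -[s]opprK sk; move: eA; move: #|A| => M; lia.
have sE := sum_double0 A0.
have c2 : chi 2 = -1.
  have := char_sum_off_ge0 two_neq0 sumsetA; rewrite A0 sE qE.
  by apply: quad_char2_parameters_in0 => //; lia.
rewrite c2 mulN1r in sE; rewrite sE; split=> //.
have [oA|eA] := boolP (odd #|A|); last first.
  have := char_sum_off_even two_neq0 sumsetA eA.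
  rewrite A0 qE sE subrr mul0r addr0.
  by apply: even_parameters_in0 => //; lia.
have := char_sum_off_odd_roots two_neq0 sumsetA oA N_neq0.
have := char_sum_off_odd two_neq0 sumsetA oA.
rewrite A0 qE sE subrr mul0r addr0.
apply: (@odd_parameters_in0 _ _ _ (#|A|./2)%:Z (Delta./2)%:Z) => //.
- by move: oA; move: #|A| => M; lia.
- by move: par; rewrite oA; lia.
by rewrite -qE (card_quad_res two_neq0); lia.
Qed.

(** The sum [s] attains its minimum [- (N - z)], so every term [chi (2 * a)] is minimal: -1 for
    [a != 0], and 0 for [a = 0]. *)
Lemma double_notin_quad_res (a : F) : a \in A -> 2 * a \notin R.
Proof.
case: summand_parameters => _ sE _ _ aA.
have pos (b : F) : b \in A -> 0 <= chi (2 * b) + 1 - (b == 0)%:Z.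
  move=> _; have := quad_charP (2 * b); rewrite mulf_eq0 (negbTE two_neq0) /=.
  by case.
have sum0 : \sum_(b in A) (chi (2 * b) + 1 - (b == 0)%:Z) = 0.
  by rewrite !big_split /= sumrN sum_mem_zero sum1_int sE; ring.
apply/negP => aR; have := psumr_eq0P pos sum0 aA; rewrite quad_char_res //.
rewrite (_ : (a == 0) = false) //; apply/negbTE.
by apply: contraTneq aR => ->; rewrite mulr0 quad_res0.
Qed.

End Classification.

(** * Unique representation of sums, and the perfect difference property *)

Section PerfectDifferenceSet.

Variable F : finFieldType.
Hypothesis two_neq0 : (2 : F) != 0.

Local Notation R := (quad_res F).
Local Notation chi := (@quad_char F).

Variable A : {set F}.
Hypothesis sumsetA : restricted_sumset A = R.
Hypothesis card_pairs : (#|A| * #|A|.-1 = 2 * #|R|)%N.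
Hypothesis doubleA : forall a, a \in A -> 2 * a \notin R.

(** At least 2 for each [r], with total [2 * #|R|]: equality holds termwise. *)
Lemma card_reps_eq2 (r : F) : r \in R -> #|sum_reps A r| = 2%N.
Proof.
have h r' : r' \in R -> (2 <= #|sum_reps A r'| ?= iff (#|sum_reps A r'| == 2%N))%N.
  by move=> rR; split; [exact: card_reps_ge2|rewrite eq_sym].
have [_] := leqif_sum h; rewrite sum_card_reps // sum_nat_const mulnC card_pairs eqxx.
by move=> /esym /forall_inP H rR; apply/eqP/H.
Qed.

Lemma autocorrE (x : F) : autocorr A x = #|[set y | (y \in A) && (y + x \in A)]|.
Proof.
rewrite /autocorr -sum1_card big_mkcond [RHS]big_mkcond /=.
by apply: eq_bigr => y _; rewrite inE; case: (y \in A); case: (y + x \in A).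
Qed.

Lemma autocorr0 : autocorr A 0 = #|A|.
Proof. by rewrite autocorrE; apply: eq_card => y; rewrite inE addr0 andbb. Qed.

Lemma sum_autocorr : (\sum_(x : F) autocorr A x = #|A| ^ 2)%N.
Proof.
rewrite exchange_big /= -mulnn -sum_nat_const [RHS]big_mkcond.
apply: eq_bigr => y _; rewrite -big_distrr /=.
rewrite (_ : (\sum_x ((y + x)%R \in A) = #|A|)%N); first by case: (y \in A); rewrite ?mul1n ?mul0n.
rewrite (reindex_inj (addrI (- y))) /= -sum1_card [RHS]big_mkcond /=.
by apply: eq_bigr => x _; rewrite addrA subrr add0r; case: (x \in A).
Qed.

(** Two ways of writing [x] as a difference give [y + (y' + x) = y' + (y + x)], which would be two
    different representations of one element of [R]. *)
Lemma autocorr_le1 (x : F) : x != 0 -> (autocorr A x <= 1)%N.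
Proof.
move=> x0; rewrite autocorrE; apply/card_le1_eqP => y y'.
rewrite !inE => /andP[yA yxA] /andP[y'A y'xA]; apply/eqP; apply: contraT => yy'.
have sE : y' + (y + x) = y + (y' + x) by ring.
have noloop (v w : F) : v \in A -> w \in A -> v + w \in R -> v != w.
  move=> vA wA vwR; apply: contraTneq vwR => <-.
  by rewrite -mulr2n -mulr_natl doubleA.
have rR : y + (y' + x) \in R.
  have [yE|] := eqVneq y (y' + x); last exact: (add_mem_quad_res sumsetA).
  (* If both representations had equal summands, then [y = y' + x] and [y' = y + x], whence
     [2 * x = 0]. *)
  rewrite -sE; apply: (add_mem_quad_res sumsetA) => //.
  apply: contraTneq x0 => y'E; rewrite negbK; apply/eqP.
  have : 2 * x = (y' + x - y) + (y + x - y') by ring.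
  rewrite -yE -y'E !subrr addr0.
  by move/eqP; rewrite mulf_eq0 (negbTE two_neq0) => /eqP.
have := card_reps_eq2 rR.
(* Three distinct ordered pairs already contradict the count of 2. *)
have sub : [set (y, y' + x); (y' + x, y); (y', y + x)] \subset sum_reps A (y + (y' + x)).
  apply/subsetP => ab; rewrite !inE => /orP[/orP[]|] /eqP-> /=.
  - by rewrite yA y'xA noloop ?eqxx.
  - by rewrite yA y'xA eq_sym noloop //= addrC.
  - by rewrite y'A yxA noloop ?sE ?eqxx.
have := subset_leq_card sub; rewrite setUC cardsU1 cards2 !inE !xpair_eqE.
have yy'x : y != y' + x by apply: noloop.
rewrite (negbTE yy'x) ?andbF ?orbF (negbTE yy') /=.
rewrite [y' == _]eq_sym -subr_eq0 addrAC subrr add0r (negbTE x0) /=.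
by move=> h3 h2; rewrite h2 in h3.
Qed.

(** Over [x != 0] the values of [autocorr A] are at most 1 and sum to [N ^ 2 - N = q - 1], the
    number of such [x]. *)
Lemma perfect_difference : perfect_difference_set A.
Proof.
move=> x x0.
have h y : y != 0 -> (autocorr A y <= 1 ?= iff (autocorr A y == 1%N))%N.
  by move=> y0; split=> //; exact: autocorr_le1.
have [_] := leqif_sum h; have := sum_autocorr.
rewrite (bigD1 0) //= autocorr0 sum1_card (cardC1 (0 : F)) card_quad_res // => tot.
rewrite (_ : (_ == _)%N).
  by move=> /esym /forall_inP H; apply/eqP/H.
have := card_pairs; move: tot; move: (\sum_(i | _) _)%N => t; move: #|A| #|R| => M m.
by rewrite /=; nia.
Qed.

End PerfectDifferenceSet.

(** * The bound [#|A| <= 6] from a fourfold character sum *)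

Section SizeBound.

Variable F : finFieldType.
Hypothesis two_neq0 : (2 : F) != 0.

Local Notation R := (quad_res F).
Local Notation chi := (@quad_char F).
Local Notation q := (#|F|%:Z).
Local Notation sg := (chi (- 1)).

Variable A : {set F}.
Hypothesis sumsetA : restricted_sumset A = R.
Hypothesis card_pairs : (#|A| * #|A|.-1 = 2 * #|R|)%N.
Hypothesis doubleA : forall a, a \in A -> 2 * a \notin R.
Local Notation N := (#|A|%:Z).

(** A perfect difference set hits each nonzero difference once, and 0 exactly [N] times. *)
Lemma sum_diffs (g : F -> int) :
  \sum_(c in A) \sum_(a in A) g (a - c) = (N - 1) * g 0 + \sum_t g t.
Proof.
transitivity (\sum_t (autocorr A t)%:Z * g t).
  rewrite [RHS](eq_bigr (fun t => \sum_y ((y \in A) * (y + t \in A)%R)%:Z * g t)) => [|t _].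
    rewrite [RHS]exchange_big big_mkcond /=; apply: eq_bigr => c _.
    case: (c \in A); last by rewrite big1 // => t _; rewrite mul0n mul0r.
    rewrite [RHS](reindex_inj (addrI (- c))) /= big_mkcond; apply: eq_bigr => a _.
    rewrite addrA subrr add0r mul1n [- c + a]addrC.
    by case: (a \in A); rewrite ?mul1r ?mul0r.
  by rewrite -mulr_suml /autocorr -[X in X * _ = _]natz natr_sum; under eq_bigr do rewrite natz.
rewrite (bigD1 0) //= [in RHS](bigD1 0) //= autocorr0.
rewrite (eq_bigr g) => [|t t0]; first by ring.
by rewrite perfect_difference // mul1r.
Qed.

Lemma sum_pairs (g : F -> int) :
  \sum_(a in A) \sum_(b in A) g (a + b) =
    \sum_(a in A) g (2 * a) + 2 * \sum_(r in R) g r.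
Proof.
transitivity (\sum_(a in A) (g (2 * a) + \sum_(b in A | a != b) g (a + b))).
  apply: eq_bigr => a aA; rewrite (bigD1 a) //= -mulr2n -[a *+ 2]mulr_natl.
  by congr (_ + _); apply: eq_bigl => b; rewrite eq_sym.
rewrite big_split /=; congr (_ + _).
rewrite pair_big_dep /= (partition_big (fun ab => ab.1 + ab.2) (mem R)) /=; last first.
  by move=> [a b] /= /and3P[aA bA ab]; exact: (add_mem_quad_res sumsetA).
rewrite mulr_sumr; apply: eq_bigr => r rR.
rewrite (eq_bigr (fun=> g r)) => [|ab /andP[_ /eqP->]] //.
rewrite sumr_const mulr_natl; congr (_ *+ _).
transitivity #|sum_reps A r|; last exact: card_reps_eq2.
by apply: eq_card => ab; rewrite !inE unfold_in /= !andbA.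
Qed.

(** Twice the indicator of [R] is [1 - (t == 0) + chi t]. *)
Lemma sum_quad_res (g : F -> int) :
  2 * \sum_(r in R) g r = \sum_t g t - g 0 + \sum_t chi t * g t.
Proof.
have g0 : \sum_t (t == 0)%:Z * g t = g 0.
  rewrite (bigD1 0) //= eqxx mul1r big1 ?addr0 // => t /negbTE->.
  by rewrite mul0r.
rewrite -[X in _ - X]g0 -sumrB -big_split mulr_sumr big_mkcond /=.
by apply: eq_bigr => t _; case: quad_charP => *; rewrite /=; ring.
Qed.

Lemma quad_charN (x : F) : chi (- x) = sg * chi x.
Proof. by rewrite -[- x]mulN1r quad_charM. Qed.

Lemma sum_res_add (w : F) :
  2 * \sum_(r in R) chi (w + r) = - chi w + q * (w == 0)%:Z - 1.
Proof.
rewrite sum_quad_res addr0.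
under eq_bigr do rewrite addrC.
rewrite sum_quad_char_shift // add0r.
under eq_bigr do rewrite addrC.
by rewrite sum_quad_charMD // addrA.
Qed.

Lemma sum_res_sub (w : F) :
  2 * \sum_(r in R) chi (w - r) = - chi w + sg * (q * (w == 0)%:Z - 1).
Proof.
have wE t : chi (w - t) = sg * chi (t + - w) by rewrite -quad_charN opprD opprK addrC.
rewrite sum_quad_res subr0.
under eq_bigr do rewrite wE.
rewrite -mulr_sumr sum_quad_char_shift // mulr0 add0r; congr (_ + _).
under eq_bigr do rewrite wE mulrCA.
by rewrite -mulr_sumr sum_quad_charMD // oppr_eq0.
Qed.

Lemma sum_mem_eq (b : F) (P : F -> bool) : b \in A ->
  (forall a, a \in A -> P a = (a == b)) -> \sum_(a in A) (P a)%:Z = 1.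
Proof.
move=> bA Pb; rewrite (bigD1 b) //= Pb // eqxx big1 ?addr0 // => a /andP[aA ab].
by rewrite Pb // (negbTE ab).
Qed.

(* Both sides evaluate \sum chi (y + a + b - c - d) over A^4. *)
Lemma four_sum (y : F) :
  (N - 1) ^+ 2 * chi y =
    \sum_(a in A) \sum_(b in A)
      (\sum_(c in A) chi (y + (a + b) - 2 * c) - chi (y + (a + b)) +
       sg * (q * (y + (a + b) == 0)%:Z - 1)).
Proof.
have full (u : F) : \sum_(c in A) \sum_(a in A) chi (u + (a - c)) = (N - 1) * chi u.
  rewrite (sum_diffs (fun t => chi (u + t))) addr0.
  under [X in _ + X]eq_bigr do rewrite addrC.
  by rewrite sum_quad_char_shift // addr0.
transitivity (\sum_(a in A) \sum_(b in A) \sum_(c in A) \sum_(d in A)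
                 chi (y + (a + b) - (c + d))); last first.
  apply: eq_bigr => a _; apply: eq_bigr => b _.
  by rewrite (sum_pairs (fun t => chi (y + (a + b) - t))) sum_res_sub addrA.
transitivity (\sum_(d in A) \sum_(b in A) \sum_(c in A) \sum_(a in A)
                 chi (y + (b - d) + (a - c))).
  under eq_bigr do under eq_bigr do rewrite full.
  under eq_bigr do rewrite -mulr_sumr.
  by rewrite -mulr_sumr full mulrA expr2.
rewrite exchange_big [RHS]exchange_big /=; apply: eq_bigr => b _.
under eq_bigr do rewrite exchange_big.
rewrite exchange_big /=; apply: eq_bigr => a _.
rewrite exchange_big; apply: eq_bigr => c _; apply: eq_bigr => d _.
by congr chi; ring.
Qed.

(** For [y = 2 * a0] with [a0 != 0] one has [chi y = -1], and [four_sum] becomes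
    [(N - 1)^2 = 2N - 1 + X + Y + sg (N - 1)], where [X] and [Y] are the sums of [chi (y - 2 * a)]
    and [chi (y + 2 * a)] over [A]. Both are at most [N], so [N^2 - 7N + 3 <= 0]. *)
Lemma card_summand_le6 : (1 < #|A|)%N -> (#|A| <= 6)%N.
Proof.
move=> N2.
have [a0 a0A a00] : exists2 a0, a0 \in A & a0 != 0.
  have [a [b [aA bA ab]]] := card_gt1P N2.
  by have [a0|] := eqVneq a 0; [exists b; rewrite // -a0 eq_sym|exists a].
pose y : F := 2 * a0.
have y0 : y != 0 by rewrite mulf_neq0.
have chiy : chi y = -1 by case: quad_charP (doubleA a0A) y0 => // ->; rewrite eqxx.
have := four_sum y.
pose h t := \sum_(c in A) chi (y + t - 2 * c) - chi (y + t) +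
  sg * (q * (y + t == 0)%:Z - 1).
rewrite (sum_pairs h).
have -> : \sum_(a in A) h (2 * a) =
    - (N - 1) - \sum_(a in A) chi (y + 2 * a) - sg * N.
  rewrite !big_split /= sumrN -mulr_sumr big_split /= -mulr_sumr sumrN sum1_int.
  (* [y + 2 * a = 0] would put [- a0] in [A], forcing [a0 = 0]. *)
  rewrite [X in q * X]big1 => [|a aA]; last first.
    rewrite /y -mulrDr mulf_eq0 (negbTE two_neq0) /= addr_eq0.
    case: eqP => // a0E; move: aA a00; rewrite -[a]opprK -a0E.
    by rewrite (opp_mem_eq0 two_neq0 sumsetA a0A) => ->.
  rewrite mulr0 sub0r mulrN; congr (_ - _ - _).
  rewrite exchange_big /=.
  rewrite (eq_bigr (fun c => \sum_(a in A) chi (y + 2 * (a - c)))) => [|c _]; last first.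
    by apply: eq_bigr => a _; congr chi; ring.
  rewrite (sum_diffs (fun t => chi (y + 2 * t))) mulr0 addr0 chiy mulrN1.
  have := sum_quad_char_shift two_neq0 y; rewrite (reindex_inj (mulfI two_neq0)) /=.
  by under eq_bigr do rewrite addrC; move=> ->; rewrite addr0.
have -> : 2 * \sum_(r in R) h r = - \sum_(a in A) chi (y - 2 * a) + q - N
    + sg * (2 * (q * (- y \in R)%:Z - #|R|%:Z)).
  rewrite !big_split /= sumrN !mulrDr exchange_big /=.
  have -> : 2 * \sum_(c in A) \sum_(r in R) chi (y + r - 2 * c) =
      - \sum_(a in A) chi (y - 2 * a) + q - N.
    rewrite mulr_sumr (eq_bigr (fun c => - chi (y - 2 * c) + q * (y - 2 * c == 0)%:Z - 1)).
      rewrite !big_split /= !sumrN sum1_int -mulr_sumr.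
      rewrite (@sum_mem_eq a0) ?mulr1 // => a aA.
      by rewrite subr_eq0 (inj_eq (mulfI two_neq0)) eq_sym.
    by move=> c _; rewrite -sum_res_add; congr (2 * _); apply: eq_bigr => r _; rewrite addrAC.
  have -> : 2 * - \sum_(r in R) chi (y + r) = 0.
    by rewrite mulrN sum_res_add (negbTE y0) chiy mulr0.
  rewrite addr0.
  congr (_ + _); rewrite -mulr_sumr mulrCA -!mulrDr; congr (_ * (_ * _)).
  rewrite big_split /= sumrN sumr_const natz -mulr_sumr; congr (_ * _ - _).
  rewrite big_mkcond (bigD1 (- y)) //= subrr eqxx big1 ?addr0 => [|r ry].
    by case: ifP.
  by rewrite addrC addr_eq0 (negbTE ry) if_same.
have qE : q = 2 * #|R|%:Z + 1 by rewrite card_quad_res; lia.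
have sg1 : sg = 1 \/ sg = -1.
  case: (quad_charP (-1 : F)) => [/eqP|_|_ _]; [|by left|by right].
  by rewrite oppr_eq0 (negbTE (oner_neq0 _)).
(* Since [chi (- y) = - sg], [- y] is in [R] exactly when [sg = -1]. *)
have RE : 2 * (- y \in R)%:Z = 1 - sg.
  have := quad_charN y; rewrite chiy.
  by case: sg1 => ->; case: (quad_charP (- y)).
have RE2 : sg * (2 * (q * (- y \in R)%:Z - #|R|%:Z)) = sg - q.
  rewrite (_ : 2 * _ = q * (2 * (- y \in R)%:Z) - 2 * #|R|%:Z); last by ring.
  rewrite RE (_ : 2 * #|R|%:Z = q - 1); last by rewrite qE addrK.
  by case: sg1 => ->; ring.
have bound (v : int) : \sum_(a in A) chi (y + v%:~R * a) <= N.
  rewrite -(sum1_int A); apply: ler_sum => a _.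
  by case/andP: (quad_char_bounds (y + v%:~R * a)).
have := bound 2; have := bound (-2).
rewrite RE2 chiy; under eq_bigr do rewrite mulrNz mulNr.
move: (\sum_(a in A) chi (y - 2 * a)) (\sum_(a in A) chi (y + 2 * a)) => X Y.
clear -sg1 N2; move: N2; move: #|A| => M N2 X_le Y_le.
by case: sg1 => -> h; nia.
Qed.

End SizeBound.

(** * Specialization to ['F_p] and the three assertions *)

Lemma restricted_sumset_structure (p n Delta : nat) (A : {set 'F_p}) :
  prime p -> odd p -> (0 < n)%N -> p = (n ^ 2 + Delta)%N ->
  (1 <= Delta <= 2 * n)%N -> restricted_sumset A = quad_res 'F_p ->
  [/\ #|A| = n.+1, Delta = n.+1,
      forall a, a \in A -> 2 * a \notin quad_res 'F_p,
      perfect_difference_set A & (#|A| <= 6)%N] /\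
  [/\ 0 \notin A -> quad_char (2 : 'F_p) = 1 &
      0 \in A -> quad_char (2 : 'F_p) = -1].
Proof.
move=> p_pr p_odd n_gt0 pE /andP[D_gt0 D_le] sumsetA.
have natF k : ((k%:R : 'F_p) == 0) = (p %| k)%N.
  by rewrite -(dvdn_pcharf (pchar_Fp p_pr)).
have two_neq0 : (2 : 'F_p) != 0.
  rewrite natF; apply/negP => /(dvdn_leq (ltn0Sn _)) p2.
  by case: p p_pr p_odd p2 {A pE sumsetA natF} => [|[|[]]].
have cardF : #|'F_p| = (n ^ 2 + Delta)%N by rewrite card_Fp.
have NE := card_summand two_neq0 sumsetA n_gt0 cardF D_gt0 D_le.
(* [p] cannot divide [n + 1]: for [n >= 2], [p > n ^ 2 >= n + 1], and for [n = 1] it would give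
   [p = 2]. *)
have N_neq0 : (#|A|%:R : 'F_p) != 0.
  rewrite natF NE; apply/negP => /(dvdn_leq (ltn0Sn _)).
  have [n1|n2] := leqP n 1; last by rewrite pE; nia.
  have n1E : n = 1%N by lia.
  move=> p2; have := p_odd; have -> : p = 2%N by move: p2 pE; rewrite n1E; lia.
  by [].
have [DE _ chi1 chiN1] := summand_parameters two_neq0 sumsetA n_gt0 cardF D_gt0 D_le N_neq0.
have dbl := double_notin_quad_res two_neq0 sumsetA n_gt0 cardF D_gt0 D_le N_neq0.
have card_pairs : (#|A| * #|A|.-1 = 2 * #|quad_res 'F_p|)%N.
  have := card_quad_res two_neq0; rewrite cardF DE NE /=.
  by move: #|quad_res _| => m; nia.
split=> //; split=> //; first by rewrite DE.
  exact: perfect_difference.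
by apply: card_summand_le6; rewrite // NE.
Qed.

Lemma quad_res_double_empty (F : finFieldType) (A : {set F}) :
  (forall a, a \in A -> 2 * a \notin quad_res F) ->
  double_set A :&: quad_res F = set0.
Proof.
move=> h; apply/setP => x; rewrite in_setI in_set0; apply/negP => /andP[].
by move=> /imsetP[a aA ->]; apply/negP/h.
Qed.

Theorem theorem18 (K : rcfType) (p n Delta : nat) (A : {set 'F_p})
    (p_prime : prime p) (p_odd : odd p) (n_gt0 : (0 < n)%N)
    (pE : p = (n ^ 2 + Delta)%N) (Delta_bounds : (1 <= Delta <= 2 * n)%N) :
  [/\ restricted_sumset A = quad_res 'F_p ->
      ~ (p = 3%N /\ A = [set 0; 1]) ->
      [/\ #|A| = n.+1,
          (3 <= Delta <= n.+1)%N,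
          #|double_set A :&: quad_res 'F_p|%:R <=
            2^-1 * Num.sqrt (#|A|%:R * Delta%:R - 3 * #|A|%:R + 1) :> K,
          0 \notin A -> quad_char (2 : 'F_p) = 1 /\ (#|A| <= 6)%N
        & 0 \in A -> quad_char (2 : 'F_p) = -1 /\
            (Delta = n.+1 -> perfect_difference_set A)],
      restricted_sumset A = quad_res 'F_p ->
      forall (E1 : int) (E2 : 'F_p -> int),
      (additive_energy A)%:Z = 2 * #|A|%:Z ^+ 2 - #|A|%:Z + E1 ->
      (forall x : 'F_p,
         (autocorr A x)%:Z = (#|A|%:Z - 1) * delta0 x + 1 + E2 x) ->
      let d : K := #|A|%:R - Delta%:R in
      [/\ E1%:~R <= 6 * d + 2 * #|A|%:R +
            Num.min (d * #|A|%:R)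
              (Num.min (#|A|%:R * Num.sqrt (3 * d)) (d ^+ 2)),
          \sum_(x : 'F_p) E2 x = #|A|%:Z - Delta%:Z
        & \sum_(x : 'F_p) E2 x ^+ 2 = E1 + Delta%:Z - #|A|%:Z]
    & restricted_sumset A = quad_res 'F_p ->
      [/\ perfect_difference_set A,
          ~~ odd #|A| -> (#|A| <= 6)%N
        & odd #|A| -> (#|A| <= 5)%N]].
Proof.
have main : restricted_sumset A = quad_res 'F_p -> _ :=
  restricted_sumset_structure p_prime p_odd n_gt0 pE Delta_bounds.
split=> sumsetA; have [[NE DE dbl pds N6] [chi1 chiN1]] := main sumsetA.
- move=> not3; split=> //.
  (* As [Delta = n + 1], only [n = 1] must be excluded; there [p = 3] and [R = {1}], and [A] turns
     out to be [{0, 1}]. *)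
  + rewrite DE leqnn andbT ltnS ltn_neqAle n_gt0 andbT.
    apply/negP => /eqP n1; apply: not3.
    have p3 : p = 3%N by rewrite pE DE -n1.
    split=> //.
    have two_neq0 : (2 : 'F_p) != 0.
      by rewrite -(dvdn_pcharf (pchar_Fp p_prime)) p3.
    have R1 : #|quad_res 'F_p| = 1%N.
      have := card_quad_res two_neq0; rewrite card_Fp // {1}p3.
      by move: #|quad_res _| => m; lia.
    have [r Rr] : exists r, quad_res 'F_p = [set r] by apply/cards1P; rewrite R1.
    have r1 : 1 = r.
      apply/set1P; rewrite -Rr -(expr1n 'F_p 2) quad_res_sqr ?oner_neq0 //.
    (* If 0 is not in [A], then [chi 2 = 1] puts 2 in [R = {1}], which is absurd. *)
    have [A0|A0] := boolP (0 \in A); last first.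
      have := chi1 A0; case: quad_charP => // + _.
      rewrite Rr -r1 inE -subr_eq0 (_ : 2 - 1 = 1); last by ring.
      by rewrite (negbTE (oner_neq0 _)).
    apply/esym/eqP; rewrite eqEcard cards2 NE -n1 eq_sym oner_neq0 andbT.
    apply/subsetP => x; rewrite !inE => /orP[]/eqP-> //.
    (* Write [1 = a + b]. Either [a = 0] and [b = 1], or [0 + a] lies in [R = {1}] and [a = 1]. *)
    have : (1 : 'F_p) \in quad_res 'F_p by rewrite Rr -r1 set11.
    move=> /(quad_res_addP sumsetA)[a [b [aA bA ab]]].
    have [a0|a0] := eqVneq a 0; first by rewrite a0 add0r => ->.
    have := add_mem_quad_res sumsetA A0 aA; rewrite eq_sym a0 add0r Rr -r1 inE.
    by move=> /(_ isT)/eqP <-.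
  + rewrite quad_res_double_empty // cards0 mulr_ge0 ?invr_ge0 ?ler0n //.
    exact: sqrtr_ge0.
  + by move=> A0; split=> //; exact: chi1.
  + by move=> A0; split=> //; exact: chiN1.
(* Both error terms and [d] vanish, so the bound reads [0 <= 2 * #|A|]. *)
- move=> E1 E2 E1E E2E d.
  have NZ : #|A|%:Z = n%:Z + 1 by rewrite NE; lia.
  have d0 : d = 0 by rewrite /d NE DE subrr.
  have E20 x : E2 x = 0.
    have := E2E x; rewrite /delta0; have [->|x0] := eqVneq x 0.
      by rewrite autocorr0 NZ; lia.
    by rewrite pds //; lia.
  (* The energy is [N ^ 2 + (p - 1)] with [p - 1 = N * (N - 1)]. *)
  have E10 : E1 = 0.
    have : (additive_energy A = #|A| ^ 2 + p.-1)%N.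
      rewrite /additive_energy (bigD1 0) //= autocorr0; congr (_ + _)%N.
      rewrite (eq_bigr (fun=> 1%N)) => [|x x0]; last by rewrite pds.
      by rewrite sum1_card (cardC1 (0 : 'F_p)) card_Fp.
    have pE' : p.-1 = (n * n.+1)%N by rewrite [in LHS]pE DE -mulnn; nia.
    by rewrite NE pE' => eE; move: E1E; rewrite eE NE; nia.
  have D0 : #|A|%:Z - Delta%:Z = 0 by rewrite NE DE subrr.
  split.
  + rewrite E10 d0 mulr0 add0r mul0r expr2 !mulr0 sqrtr0 mulr0 !minxx addr0.
    by rewrite mulr_ge0 ?ler0n.
  + by rewrite D0 big1.
  + by rewrite E10 add0r -opprB D0 oppr0 big1 // => x _; rewrite E20 expr0n.
- split=> // oA; have : #|A| != 6%N by apply: contraTneq oA => ->.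
  by move: N6; case: ltngtP.
Qed.
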